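(* Let $F$ be a field and let $L$ be an $n$-dimensional non-abelian nilpotent Lie algebra over $F$ whose derived subalgebra $L^2=[L,L]$ has dimension $m$. Then \[\dim (L\otimes L)\leq (n-m)(n-1)+2 .\] In particular, for $m=1$ the equality $\dim(L\otimes L)=(n-m)(n-1)+2$ holds if and only if $L\cong H(1)\oplus A(n-3)$.
   Context: All Lie algebras are over a fixed arbitrary field $F$, and $\dim$ denotes dimension over $F$. For a Lie algebra $L$, $L^2=[L,L]$ is its derived subalgebra. The (non-abelian) tensor square $L\otimes L$ is the Lie algebra over $F$ generated by symbols $a\otimes b$ ($a,b\in L$) subject to the following relations, for all $c\in F$ and $a,a',b,b'\in L$: (i) $c(a\otimes b)=(ca)\otimes b=a\otimes(cb)$; (ii) $(a+a')\otimes b=a\otimes b+a'\otimes b$ and $a\otimes(b+b')=a\otimes b+a\otimes b'$; (iii) $[a,a']\otimes b=a\otimes[a',b]-a'\otimes[a,b]$ and $a\otimes[b,b']=[b',a]\otimes b-[b,a]\otimes b'$; (iv) $[a\otimes b,\,a'\otimes b']=-[b,a]\otimes[a',b']$. (This is the non-abelian tensor product of $L$ with itself, with $L$ acting on itself by ${}^{x}y=[x,y]$.) $H(1)$ denotes the $3$-dimensional Heisenberg Lie algebra over $F$, with basis $v_1,v_2,v$ whose only non-zero brackets of basis elements are $[v_1,v_2]=-[v_2,v_1]=v$. $A(k)$ denotes the abelian Lie algebra of dimension $k$ over $F$ (with $A(0)=0$). *)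

(* Defs.v *)
From HB Require Import structures.
From mathcomp Require Import all_boot all_order all_algebra.
From mathcomp Require Import generic_quotient boolp.
From mathcomp Require Import ring.

Set Implicit Arguments.
Unset Strict Implicit.
Unset Printing Implicit Defensive.

Import GRing.Theory.
Local Open Scope ring_scope.
Local Open Scope quotient_scope.

HB.mixin Record Lmodule_isLieAlgebra (F : fieldType) L of GRing.Lmodule F L := {
  lie : L -> L -> L;
  lie_linearl : forall z : L, linear (lie^~ z);
  lie_linearr : forall z : L, linear (lie z);
  liexx : forall x : L, lie x x = 0;
  lie_jacobi : forall x y z : L,
    lie x (lie y z) + lie y (lie z x) + lie z (lie x y) = 0
}.

#[short(type="lieAlgType")]
HB.structure Definition LieAlgebra (F : fieldType) :=
  { L of Lmodule_isLieAlgebra F L & GRing.Lmodule F L }.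

#[short(type="vectLieType")]
HB.structure Definition VectLieAlgebra (F : fieldType) :=
  { L of LieAlgebra F L & Vector F L }.

Definition lie_morphism (F : fieldType) (L M : lieAlgType F)
    (f : {linear L -> M}) : Prop :=
  forall x y, f (lie x y) = lie (f x) (f y).

Definition lie_isomorphic (F : fieldType) (L M : lieAlgType F) : Prop :=
  exists f : {linear L -> M}, lie_morphism f /\ bijective f.

Definition lie_abelian (F : fieldType) (L : lieAlgType F) : Prop :=
  forall x y : L, lie x y = 0.

(* Usable on modules not known in advance to be finite-dimensional, for which
   \dim is not available. *)
Definition has_dim (F : fieldType) (V : lmodType F) (d : nat) : Prop :=
  exists f : {linear V -> 'rV[F]_d}, bijective f.

Section LieSubspaces.
Variables (F : fieldType) (L : vectLieType F).

Definition lieprodv (U V : {vspace L}) : {vspace L} :=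
  <<allpairs (@lie F L) (vbasis U) (vbasis V)>>%VS.

Lemma lieprodvP (U V W : {vspace L}) :
  reflect {in U & V, forall u v, lie u v \in W} (lieprodv U V <= W)%VS.
Proof.
apply: (iffP idP) => [sUVW u v Uu Vv | sUVW]; last first.
  apply/span_subvP => _ /allpairsP[[u v] /= [Uu Vv ->]].
  by rewrite sUVW ?vbasis_mem.
rewrite (subvP sUVW) // /lieprodv.
pose lL (z : L) : {linear L -> L} := HB.pack (lie^~ z)
  (GRing.isLinear.Build F L L _ (lie^~ z) (lie_linearl z)).
pose lR (z : L) : {linear L -> L} := HB.pack (lie z)
  (GRing.isLinear.Build F L L _ (lie z) (lie_linearr z)).
rewrite (coord_vbasis Uu) -[lie _ _]/(lL v _) linear_sum memv_suml // => i _.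
rewrite linearZ memvZ //= (coord_vbasis Vv).
rewrite -[lie _ _]/(lR (vbasis U)`_i _) linear_sum memv_suml // => j _.
rewrite linearZ memvZ //= memv_span //.
by apply/allpairsP; exists ((vbasis U)`_i, (vbasis V)`_j); rewrite !memt_nth.
Qed.

Definition derived : {vspace L} := lieprodv fullv fullv.

Fixpoint lower_central (k : nat) : {vspace L} :=
  if k is k'.+1 then lieprodv (lower_central k') fullv else fullv.

Definition lie_nilpotent : Prop := exists k, lower_central k = 0%VS.

End LieSubspaces.

Section DirectSum.
Variables (F : fieldType) (L M : lieAlgType F).

Definition prod_lie (x y : L * M) : L * M := (lie x.1 y.1, lie x.2 y.2).

Fact prod_lie_linearl z : linear (prod_lie^~ z).
Proof. by move=> a x y; congr pair; rewrite /= lie_linearl. Qed.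
Fact prod_lie_linearr z : linear (prod_lie z).
Proof. by move=> a x y; congr pair; rewrite /= lie_linearr. Qed.
Fact prod_liexx x : prod_lie x x = 0.
Proof. by congr pair; rewrite /= liexx. Qed.
Fact prod_lie_jacobi x y z :
  prod_lie x (prod_lie y z) + prod_lie y (prod_lie z x)
    + prod_lie z (prod_lie x y) = 0.
Proof. by congr pair; rewrite /= lie_jacobi. Qed.

HB.instance Definition _ := Lmodule_isLieAlgebra.Build F (L * M)%type
  prod_lie_linearl prod_lie_linearr prod_liexx prod_lie_jacobi.

End DirectSum.

Definition abelianLie (F : fieldType) (k : nat) : Type := 'rV[F]_k.

Section AbelianLie.
Variables (F : fieldType) (k : nat).

HB.instance Definition _ := Vector.copy (abelianLie F k) 'rV[F]_k.

Definition abelian_lie (x y : abelianLie F k) : abelianLie F k := 0.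

Fact abelian_lie_linearl z : linear (abelian_lie^~ z).
Proof. by move=> a x y; rewrite /abelian_lie scaler0 addr0. Qed.
Fact abelian_lie_linearr z : linear (abelian_lie z).
Proof. by move=> a x y; rewrite /abelian_lie scaler0 addr0. Qed.
Fact abelian_liexx x : abelian_lie x x = 0.
Proof. by []. Qed.
Fact abelian_lie_jacobi x y z :
  abelian_lie x (abelian_lie y z) + abelian_lie y (abelian_lie z x)
    + abelian_lie z (abelian_lie x y) = 0.
Proof. by rewrite /abelian_lie !addr0. Qed.

HB.instance Definition _ := Lmodule_isLieAlgebra.Build F (abelianLie F k)
  abelian_lie_linearl abelian_lie_linearr abelian_liexx abelian_lie_jacobi.

End AbelianLie.

(* H(1): the basis v1, v2, v is the standard basis of 'rV_3, in this order. *)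
Definition heisenbergLie (F : fieldType) : Type := 'rV[F]_3.

Section HeisenbergLie.
Variable F : fieldType.

HB.instance Definition _ := Vector.copy (heisenbergLie F) 'rV[F]_3.

Definition heisenberg_lie (x y : 'rV[F]_3) : 'rV[F]_3 :=
  (x 0 0 * y 0 1 - x 0 1 * y 0 0) *: delta_mx 0 2.

Fact heisenberg_lie_linearl z : linear (heisenberg_lie^~ z).
Proof.
by move=> a x y; rewrite /heisenberg_lie scalerA -scalerDl !mxE; congr (_ *: _); ring.
Qed.
Fact heisenberg_lie_linearr z : linear (heisenberg_lie z).
Proof.
by move=> a x y; rewrite /heisenberg_lie scalerA -scalerDl !mxE; congr (_ *: _); ring.
Qed.
Fact heisenberg_liexx x : heisenberg_lie x x = 0.
Proof. by rewrite /heisenberg_lie mulrC subrr scale0r. Qed.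
Fact heisenberg_lie_jacobi x y z :
  heisenberg_lie x (heisenberg_lie y z) + heisenberg_lie y (heisenberg_lie z x)
    + heisenberg_lie z (heisenberg_lie x y) = 0.
Proof. by rewrite /heisenberg_lie !mxE /= !(mulr0, subr0, scale0r, addr0). Qed.

HB.instance Definition _ := Lmodule_isLieAlgebra.Build F (heisenbergLie F)
  heisenberg_lie_linearl heisenberg_lie_linearr
  heisenberg_liexx heisenberg_lie_jacobi.

End HeisenbergLie.

(* Lie algebras given by generators and relations: formal Lie expressions in
   the generators X, modulo the least congruence that contains the relations R
   and makes the quotient a Lie algebra over F. *)
Inductive lie_term (F X : Type) : Type :=
  | LGen of X
  | LZero
  | LAdd of lie_term F X & lie_term F X
  | LScale of F & lie_term F X
  | LBr of lie_term F X & lie_term F X.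
Arguments LGen {F X}.
Arguments LZero {F X}.

HB.instance Definition _ (F X : Type) := gen_eqMixin (lie_term F X).
HB.instance Definition _ (F X : Type) := gen_choiceMixin (lie_term F X).

Definition LOpp (F : fieldType) (X : Type) (t : lie_term F X) := LScale (-1) t.

Inductive lie_cong (F : fieldType) (X : Type)
    (R : lie_term F X -> lie_term F X -> Prop) :
    lie_term F X -> lie_term F X -> Prop :=
  | lc_rel s t : R s t -> lie_cong R s t
  | lc_refl t : lie_cong R t t
  | lc_sym s t : lie_cong R s t -> lie_cong R t s
  | lc_trans s t u : lie_cong R s t -> lie_cong R t u -> lie_cong R s u
  | lc_add s s' t t' : lie_cong R s s' -> lie_cong R t t' ->
      lie_cong R (LAdd s t) (LAdd s' t')
  | lc_scale c t t' : lie_cong R t t' -> lie_cong R (LScale c t) (LScale c t')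
  | lc_br s s' t t' : lie_cong R s s' -> lie_cong R t t' ->
      lie_cong R (LBr s t) (LBr s' t')
  | lc_addA s t u : lie_cong R (LAdd s (LAdd t u)) (LAdd (LAdd s t) u)
  | lc_addC s t : lie_cong R (LAdd s t) (LAdd t s)
  | lc_add0 t : lie_cong R (LAdd LZero t) t
  | lc_addN t : lie_cong R (LAdd (LOpp t) t) LZero
  | lc_scaleA c d t : lie_cong R (LScale c (LScale d t)) (LScale (c * d) t)
  | lc_scale1 t : lie_cong R (LScale 1 t) t
  | lc_scaleDr c s t :
      lie_cong R (LScale c (LAdd s t)) (LAdd (LScale c s) (LScale c t))
  | lc_scaleDl c d t :
      lie_cong R (LScale (c + d) t) (LAdd (LScale c t) (LScale d t))
  | lc_brl c s t u : lie_cong R (LBr (LAdd (LScale c s) t) u)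
      (LAdd (LScale c (LBr s u)) (LBr t u))
  | lc_brr c s t u : lie_cong R (LBr u (LAdd (LScale c s) t))
      (LAdd (LScale c (LBr u s)) (LBr u t))
  | lc_brxx t : lie_cong R (LBr t t) LZero
  | lc_jacobi s t u : lie_cong R
      (LAdd (LAdd (LBr s (LBr t u)) (LBr t (LBr u s))) (LBr u (LBr s t)))
      LZero.

Section PresentedLie.
Variables (F : fieldType) (X : Type).
Variable R : lie_term F X -> lie_term F X -> Prop.

Definition lie_congb : rel (lie_term F X) := fun s t => `[< lie_cong R s t >].

Fact lie_congb_equiv : equiv_class_of lie_congb.
Proof.
split=> [t|s t|t s u].
- by apply/asboolP; apply: lc_refl.
- by apply/asboolP/asboolP => /lc_sym.
- by move=> /asboolP st /asboolP tu; apply/asboolP; apply: lc_trans st tu.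
Qed.

Canonical lie_congb_equivRel := EquivRelPack lie_congb_equiv.

Definition presentedLie := {eq_quot lie_congb}.

HB.instance Definition _ := Choice.on presentedLie.
HB.instance Definition _ := Quotient.on presentedLie.

Definition lpi (t : lie_term F X) : presentedLie := \pi_presentedLie t.

Lemma lpiP s t : lpi s = lpi t <-> lie_cong R s t.
Proof.
split=> [/eqmodP/asboolP //|st].
by apply/eqmodP/asboolP.
Qed.

Lemma lpiW (P : presentedLie -> Prop) : (forall t, P (lpi t)) -> forall x, P x.
Proof. by move=> Pt x; rewrite -[x]reprK; apply: Pt. Qed.

Let repr_lpi t : lie_cong R (repr (lpi t)) t.
Proof. by apply/lpiP; rewrite /lpi reprK. Qed.

Definition padd (x y : presentedLie) := lpi (LAdd (repr x) (repr y)).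
Definition pscale c (x : presentedLie) := lpi (LScale c (repr x)).
Definition pbr (x y : presentedLie) := lpi (LBr (repr x) (repr y)).

Lemma lpi_add s t : lpi (LAdd s t) = padd (lpi s) (lpi t).
Proof. by apply/lpiP/lc_sym/lc_add; apply: repr_lpi. Qed.
Lemma lpi_scale c t : lpi (LScale c t) = pscale c (lpi t).
Proof. by apply/lpiP/lc_sym/lc_scale; apply: repr_lpi. Qed.
Lemma lpi_br s t : lpi (LBr s t) = pbr (lpi s) (lpi t).
Proof. by apply/lpiP/lc_sym/lc_br; apply: repr_lpi. Qed.

Fact paddA : associative padd.
Proof.
elim/lpiW=> s; elim/lpiW=> t; elim/lpiW=> u.
by rewrite -!lpi_add; apply/lpiP/lc_addA.
Qed.
Fact paddC : commutative padd.
Proof.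
by elim/lpiW=> s; elim/lpiW=> t; rewrite -!lpi_add; apply/lpiP/lc_addC.
Qed.
Fact padd0 : left_id (lpi LZero) padd.
Proof. by elim/lpiW=> t; rewrite -lpi_add; apply/lpiP/lc_add0. Qed.
Fact paddN : left_inverse (lpi LZero) (pscale (-1)) padd.
Proof.
by elim/lpiW=> t; rewrite -lpi_scale -lpi_add; apply/lpiP/lc_addN.
Qed.

HB.instance Definition _ :=
  GRing.isZmodule.Build presentedLie paddA paddC padd0 paddN.

Lemma lpi0 : lpi LZero = 0. Proof. by []. Qed.
Lemma lpiD s t : lpi (LAdd s t) = lpi s + lpi t.
Proof. exact: lpi_add. Qed.

Fact pscaleA c d (x : presentedLie) : pscale c (pscale d x) = pscale (c * d) x.
Proof.
by elim/lpiW: x => t; rewrite -!lpi_scale; apply/lpiP/lc_scaleA.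
Qed.
Fact pscale1 : left_id 1 pscale.
Proof. by elim/lpiW=> t; rewrite -lpi_scale; apply/lpiP/lc_scale1. Qed.
Fact pscaleDr : right_distributive pscale +%R.
Proof.
move=> c; elim/lpiW=> s; elim/lpiW=> t.
by rewrite -lpiD -!lpi_scale -lpiD; apply/lpiP/lc_scaleDr.
Qed.
Fact pscaleDl (x : presentedLie) : {morph pscale^~ x : c d / c + d}.
Proof.
move=> c d; elim/lpiW: x => t /=.
by rewrite -!lpi_scale -lpiD; apply/lpiP/lc_scaleDl.
Qed.

HB.instance Definition _ := GRing.Zmodule_isLmodule.Build F presentedLie
  pscaleA pscale1 pscaleDr pscaleDl.

Lemma lpiZ c t : lpi (LScale c t) = c *: lpi t.
Proof. exact: lpi_scale. Qed.
Lemma lpiN t : lpi (LOpp t) = - lpi t.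
Proof. by rewrite lpiZ scaleN1r. Qed.

Fact pbr_linearl z : linear (pbr^~ z).
Proof.
move=> c; elim/lpiW=> s; elim/lpiW=> t; elim/lpiW: z => u /=.
by rewrite -lpiZ -lpiD -!lpi_br -lpiZ -lpiD; apply/lpiP/lc_brl.
Qed.
Fact pbr_linearr z : linear (pbr z).
Proof.
move=> c; elim/lpiW=> s; elim/lpiW=> t; elim/lpiW: z => u /=.
by rewrite -lpiZ -lpiD -!lpi_br -lpiZ -lpiD; apply/lpiP/lc_brr.
Qed.
Fact pbrxx x : pbr x x = 0.
Proof. by elim/lpiW: x => t; rewrite -lpi_br; apply/lpiP/lc_brxx. Qed.
Fact pbr_jacobi x y z : pbr x (pbr y z) + pbr y (pbr z x) + pbr z (pbr x y) = 0.
Proof.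
elim/lpiW: x => s; elim/lpiW: y => t; elim/lpiW: z => u.
by rewrite -!lpi_br -!lpiD; apply/lpiP/lc_jacobi.
Qed.

HB.instance Definition _ := Lmodule_isLieAlgebra.Build F presentedLie
  pbr_linearl pbr_linearr pbrxx pbr_jacobi.

Lemma lpiB s t : lpi (LBr s t) = lie (lpi s) (lpi t).
Proof. exact: lpi_br. Qed.

End PresentedLie.

Section TensorSquare.
Variables (F : fieldType) (L : lieAlgType F).

Local Notation "a *t b" := (LGen (a, b)) (at level 38).

Inductive tensor_rel :
    lie_term F (L * L)%type -> lie_term F (L * L)%type -> Prop :=
  | tr_scalel c a b : tensor_rel (LScale c (a *t b)) ((c *: a) *t b)
  | tr_scaler c a b : tensor_rel (LScale c (a *t b)) (a *t (c *: b))
  | tr_addl a a' b : tensor_rel ((a + a') *t b) (LAdd (a *t b) (a' *t b))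
  | tr_addr a b b' : tensor_rel (a *t (b + b')) (LAdd (a *t b) (a *t b'))
  | tr_liel a a' b : tensor_rel (lie a a' *t b)
      (LAdd (a *t lie a' b) (LOpp (a' *t lie a b)))
  | tr_lier a b b' : tensor_rel (a *t lie b b')
      (LAdd (lie b' a *t b) (LOpp (lie b a *t b')))
  | tr_br a b a' b' : tensor_rel (LBr (a *t b) (a' *t b'))
      (LOpp (lie b a *t lie a' b')).

Definition tensor_square : lieAlgType F := presentedLie tensor_rel.

Definition tensor (a b : L) : tensor_square := lpi tensor_rel (a *t b).

Lemma tensor_square_univ (M : lieAlgType F) (h : L -> L -> M) :
  (forall b, linear (h^~ b)) -> (forall a, linear (h a)) ->
  (forall a a' b, h (lie a a') b = h a (lie a' b) - h a' (lie a b)) ->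
  (forall a b b', h a (lie b b') = h (lie b' a) b - h (lie b a) b') ->
  (forall a b a' b', lie (h a b) (h a' b') = - h (lie b a) (lie a' b')) ->
  exists2 f : {linear tensor_square -> M},
    lie_morphism f /\ (forall a b, f (tensor a b) = h a b) &
    forall g : {linear tensor_square -> M},
      lie_morphism g -> (forall a b, g (tensor a b) = h a b) -> g =1 f.
Proof.
move=> hl hr hliel hlier hbr.
pose ev := fix ev (t : lie_term F (L * L)%type) : M :=
  match t with
  | LGen p => h p.1 p.2
  | LZero => 0
  | LAdd s u => ev s + ev u
  | LScale c u => c *: ev u
  | LBr s u => lie (ev s) (ev u)
  end.
have h0l b : h 0 b = 0.
  by have := hl b (-1) 0 0; rewrite scaler0 addr0 scaleN1r addNr.
have h0r a : h a 0 = 0.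
  by have := hr a (-1) 0 0; rewrite scaler0 addr0 scaleN1r addNr.
have evP s t : lie_cong tensor_rel s t -> ev s = ev t.
  elim=> {s t} //=.
  - move=> s t [c a b|c a b|a a' b|a b b'|a a' b|a b b'|a b a' b'] /=;
      rewrite ?scaleN1r //.
    + by have := hl b c a 0; rewrite h0l !addr0.
    + by have := hr a c b 0; rewrite h0r !addr0.
    + by have := hl b 1 a a'; rewrite !scale1r.
    + by have := hr a 1 b b'; rewrite !scale1r.
  - by move=> s t u _ -> _ ->.
  - by move=> s s' t t' _ -> _ ->.
  - by move=> c t t' _ ->.
  - by move=> s s' t t' _ -> _ ->.
  - by move=> *; rewrite addrA.
  - by move=> *; rewrite addrC.
  - by move=> *; rewrite add0r.
  - by move=> *; rewrite scaleN1r addNr.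
  - by move=> *; rewrite scalerA.
  - by move=> *; rewrite scale1r.
  - by move=> *; rewrite scalerDr.
  - by move=> *; rewrite scalerDl.
  - by move=> *; rewrite lie_linearl.
  - by move=> *; rewrite lie_linearr.
  - by move=> *; rewrite liexx.
  - by move=> *; rewrite lie_jacobi.
pose f0 (x : tensor_square) : M := ev (repr x).
have f0E t : f0 (lpi _ t) = ev t by apply/evP/lpiP; rewrite /lpi reprK.
have f0lin : linear f0.
  move=> c; elim/lpiW=> s; elim/lpiW=> t.
  by rewrite -lpiZ -lpiD !f0E.
pose f : {linear tensor_square -> M} :=
  HB.pack f0 (GRing.isLinear.Build F _ M _ f0 f0lin).
exists f.
  split=> [|a b]; last exact: f0E.
  by elim/lpiW=> s; elim/lpiW=> t; rewrite -lpiB /= !f0E.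
move=> g gM gE; elim/lpiW=> t; rewrite [RHS]f0E.
elim: t => [[a b]||s IHs t IHt|c t IHt|s IHs t IHt] /=.
- exact: gE.
- by rewrite lpi0 linear0.
- by rewrite lpiD linearD IHs IHt.
- by rewrite lpiZ linearZ IHt.
- by rewrite lpiB gM IHs IHt.
Qed.

End TensorSquare.

(* Main.v *)
Require Import Defs.
From mathcomp Require Import all_boot all_algebra.
From HB Require Import structures.
From mathcomp Require Import boolp ring zify.
Set Implicit Arguments.
Unset Strict Implicit.
Unset Printing Implicit Defensive.
Import GRing.Theory.
Local Open Scope ring_scope.

(** Why the theorem holds.  The relations imply that elementary tensors span
    [L (x) L] linearly and that [a (x) c = - c (x) a] whenever [a] lies in
    [L^2] ([tensor_sym_lie]).  The relation expanding [[a, b] (x) c] shows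
    that the elements [a] for which all [a (x) y] lie in a given subspace form
    a subalgebra.  As [L] is nilpotent, a complement [U] of [L^2] generates it
    ([nilpotent_generation]), so the tensors [x (x) y] with [x] in a basis of
    [U] and [y] in a basis of [L] already span; these number [(n - m) n].
    Combining the two facts gives the Jacobi-type identity
    [a (x) [b, c] + b (x) [c, a] + c (x) [a, b] = 0] ([tensor_jacobi]).
    Since [L] is not abelian, two basis vectors [u], [v] of [U] have
    [w = [u, v] <> 0], and for each of the other [n - m - 2] basis vectors [a]
    the identity makes [a (x) w] redundant.  What remains is a spanning family
    of size [(n - m) n - (n - m - 2) = (n - m) (n - 1) + 2].

    Let now [m = 1], so that [w] spans [L^2] and is central.  If the bound is
    attained, no member of a spanning family of that size vanishes; in
    particular [u (x) w <> 0].  Let [a], [b] commute with [u] and [v].  The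
    identity for [u, a, b] reduces to [u (x) [a, b] = 0], so [[a, b] = 0].
    Hence [L] is the sum of the Heisenberg algebra on [u], [v], [w] and an
    abelian complement ([extremal_isomorphic]).  Conversely, on
    [H(1) + A(r)] there is an explicit bilinear map compatible with the
    relations whose values span a space of dimension [(r + 2)^2 + 2], and it
    factors through the tensor square ([heis_tensor_dim_geq]). *)

(** * Spanning families in modules of unknown dimension *)

Section VectorComplements.
Variable F : fieldType.

Lemma limg_surj (aT rT : vectType F) (f : {linear aT -> rT}) :
  (forall y, exists x, f x = y) -> limg (linfun f) = fullv.
Proof.
move=> f_surj; apply/eqP; rewrite eqEsubv subvf; apply/subvP=> y _.
have [x <-] := f_surj y; apply/memv_imgP; exists x; first exact: memvf.
by rewrite lfunE.
Qed.

Lemma dim_compl_line (V : vectType F) (w : V) :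
  w != 0 -> (\dim <[w]>^C + 1 = \dim {: V})%N.
Proof.
move=> nz_w; rewrite -(addv_complf <[w]>).
by rewrite dimv_disjoint_sum ?capv_compl // dim_vline nz_w addnC.
Qed.

End VectorComplements.

Section LinearSpan.
Variables (F : fieldType) (V : lmodType F).
Implicit Types (s t : seq V) (v : V).

Definition linear_pred (P : V -> Prop) : Prop :=
  P 0 /\ forall c u v, P u -> P v -> P (c *: u + v).

(** The tensor square is not known in advance to be finite-dimensional, so spans
    and freeness are Prop-valued; the coefficients are indexed by [nat] so that
    a family can be extended without transporting ordinals. *)
Definition lspan s v : Prop :=
  exists c : nat -> F, v = \sum_(i < size s) c i *: s`_i.

Lemma linear_predZ P c v : linear_pred P -> P v -> P (c *: v).
Proof. by case=> P0 PD Pv; rewrite -[_ *: _]addr0; apply: PD. Qed.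

Lemma linear_predD P u v : linear_pred P -> P u -> P v -> P (u + v).
Proof. by case=> _ PD Pu Pv; rewrite -[u]scale1r; apply: PD. Qed.

Lemma linear_predN P v : linear_pred P -> P v -> P (- v).
Proof. by move=> Plin Pv; rewrite -scaleN1r; apply: linear_predZ. Qed.

Lemma linear_predB P u v : linear_pred P -> P u -> P v -> P (u - v).
Proof. by move=> Plin Pu Pv; apply: linear_predD => //; apply: linear_predN. Qed.

Lemma linear_pred_sum P n (c : 'I_n -> F) (x : 'I_n -> V) :
  linear_pred P -> (forall i, P (x i)) -> P (\sum_i c i *: x i).
Proof.
move=> Plin Px; apply: (big_ind P); first by case: Plin.
- by move=> u v; apply: linear_predD.
- by move=> i _; apply: linear_predZ.
Qed.

Lemma lspan_linear s : linear_pred (lspan s).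
Proof.
split=> [|c u v [a ->] [b ->]].
  by exists (fun=> 0); rewrite big1 // => i _; rewrite scale0r.
exists (fun i => c * a i + b i); rewrite scaler_sumr -big_split /=.
by apply: eq_bigr => i _; rewrite scalerA scalerDl.
Qed.

Lemma lspan_mem s v : v \in s -> lspan s v.
Proof.
move=> sv; have lt_v : (index v s < size s)%N by rewrite index_mem.
exists (fun i => (i == index v s)%:R).
rewrite (bigD1 (Ordinal lt_v)) //= eqxx scale1r nth_index // big1 ?addr0 // => i.
by rewrite -val_eqE /= => /negPf->; rewrite scale0r.
Qed.

Lemma lspan_min P s v :
  linear_pred P -> {in s, forall x, P x} -> lspan s v -> P v.
Proof.
move=> Plin Ps [c ->]; apply: linear_pred_sum => // i.
by apply: Ps; rewrite mem_nth.
Qed.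

Lemma lspan_sub s t v : {subset s <= t} -> lspan s v -> lspan t v.
Proof.
by move=> st; apply: lspan_min (lspan_linear t) _ => x /st; apply: lspan_mem.
Qed.

Definition lfree s : Prop :=
  forall c : nat -> F, \sum_(i < size s) c i *: s`_i = 0 ->
  forall i, (i < size s)%N -> c i = 0.

Lemma lfree_cons v s : ~ lspan s v -> lfree s -> lfree (v :: s).
Proof.
move=> s'v free_s c; rewrite big_ord_recl /= => c0.
have c00 : c 0%N = 0.
  apply/eqP/negPn/negP => nz; apply: s'v.
  rewrite -[v](scalerK nz); apply: linear_predZ; first exact: lspan_linear.
  move/eqP: c0; rewrite addr_eq0 => /eqP->.
  by apply: linear_predN; [apply: lspan_linear | exists (c \o S)].
move: c0; rewrite c00 scale0r add0r => /(free_s (c \o S)) cS [|i] //.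
exact: cS.
Qed.

Lemma lfree_extract s :
  exists t, [/\ (size t <= size s)%N, lfree t & forall v, lspan s v -> lspan t v].
Proof.
elim: s => [|x s [t [sz_t free_t sub_t]]]; first by exists [::]; split.
have sub u (st : lspan u x) (tu : {subset t <= u}) v : lspan (x :: s) v -> lspan u v.
  apply: lspan_min; first exact: lspan_linear.
  move=> y; rewrite inE => /predU1P[-> // | /lspan_mem/sub_t].
  exact: lspan_sub.
case: (pselect (lspan t x)) => [tx | t'x].
  by exists t; split=> //; [apply: leqW | apply: sub].
exists (x :: t); split=> //; first exact: lfree_cons.
by apply: sub => [|y yt]; [apply: lspan_mem; rewrite inE eqxx | rewrite inE yt orbT].
Qed.

(** A linearly independent generating family is turned into coordinates by
    inverting the bijection that sends a row of scalars to its combination. *)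
Lemma lfree_has_dim s : lfree s -> (forall v, lspan s v) -> has_dim V (size s).
Proof.
move=> free_s span_s.
pose g (c : 'rV[F]_(size s)) := \sum_i c 0 i *: s`_i.
have g_lin : linear g.
  move=> a x y; rewrite /g scaler_sumr -big_split; apply: eq_bigr => i _.
  by rewrite !mxE scalerDl scalerA.
have g_inj x : g x = 0 -> x = 0.
  pose c i := if insub i is Some j then x 0 j else 0.
  have cE (i : 'I_(size s)) : c i = x 0 i by rewrite /c valK.
  move=> gx0; apply/rowP=> i; rewrite mxE -cE; apply: (free_s) => //.
  by rewrite -[RHS]gx0; apply: eq_bigr => j _; rewrite cE.
have g_surj v : exists x, g x = v.
  have [c ->] := span_s v; exists (\row_i c i).
  by apply: eq_bigr => i _; rewrite mxE.
pose gL : {linear 'rV[F]_(size s) -> V} :=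
  HB.pack g (GRing.isLinear.Build F _ V _ g g_lin).
have gI : injective gL.
  move=> x y /eqP; rewrite -subr_eq0 -linearB => /eqP/g_inj/eqP.
  by rewrite subr_eq0 => /eqP.
pose f v := projT1 (cid (g_surj v)).
have fK : cancel f gL by move=> v; apply: (projT2 (cid (g_surj v))).
have gK : cancel gL f by move=> x; apply: gI; rewrite fK.
pose fL : {linear V -> 'rV[F]_(size s)} :=
  HB.pack f (GRing.isLinear.Build F V _ _ f (can2_linear gK fK)).
by exists fL, gL.
Qed.

Lemma lspan_has_dim s :
  (forall v, lspan s v) -> exists2 d, has_dim V d & (d <= size s)%N.
Proof.
move=> span_s; have [t [le_ts free_t sub_t]] := lfree_extract s.
by exists (size t) => //; apply: lfree_has_dim => // v; apply: sub_t.
Qed.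

Lemma has_dim_leq d s : has_dim V d -> (forall v, lspan s v) -> (d <= size s)%N.
Proof.
move=> [f [g fK gK]] span_s.
suff sub_full : (fullv <= <<map f s>>)%VS.
  have := dimvS sub_full; rewrite dimvf /dim /= mul1n => /leq_trans; apply.
  by apply: leq_trans (dim_span _) _; rewrite size_map.
apply/subvP=> y _; rewrite -[y]gK; have [c ->] := span_s (g y).
rewrite linear_sum memv_suml // => i _.
by rewrite linearZ memvZ // memv_span // map_f // mem_nth.
Qed.

Lemma has_dim_surj d N (f : {linear V -> 'rV[F]_N}) :
  has_dim V d -> (forall y, exists x, f x = y) -> (N <= d)%N.
Proof.
move=> [g [h gK hK]] f_surj; have h_lin := can2_linear gK hK.
pose hL : {linear 'rV[F]_d -> V} := HB.pack h (GRing.isLinear.Build F _ V _ h h_lin).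
have p_surj : limg (linfun (f \o hL)) = fullv.
  apply: limg_surj => y; have [x <-] := f_surj y.
  by exists (g x); rewrite /= gK.
have := limg_ker_dim (linfun (f \o hL)) fullv.
rewrite p_surj !dimvf /dim /= !mul1n => <-.
exact: leq_addl.
Qed.

End LinearSpan.

(** * Nilpotent Lie algebras *)

Section LieBasics.
Variables (F : fieldType) (L : lieAlgType F).
Implicit Types x y z : L.

Lemma lie0l z : lie 0 z = 0.
Proof. by have := lie_linearl z (-1) 0 0; rewrite scaler0 addr0 scaleN1r addNr. Qed.
Lemma lie0r z : lie z 0 = 0.
Proof. by have := lie_linearr z (-1) 0 0; rewrite scaler0 addr0 scaleN1r addNr. Qed.
Lemma lieDl x y z : lie (x + y) z = lie x z + lie y z.
Proof. by have := lie_linearl z 1 x y; rewrite !scale1r. Qed.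
Lemma lieDr x y z : lie z (x + y) = lie z x + lie z y.
Proof. by have := lie_linearr z 1 x y; rewrite !scale1r. Qed.
Lemma lieZl c x z : lie (c *: x) z = c *: lie x z.
Proof. by have := lie_linearl z c x 0; rewrite lie0l !addr0. Qed.
Lemma lieZr c x z : lie z (c *: x) = c *: lie z x.
Proof. by have := lie_linearr z c x 0; rewrite lie0r !addr0. Qed.
Lemma lieC x y : lie x y = - lie y x.
Proof.
apply/eqP; rewrite -addr_eq0; have := liexx (x + y).
by rewrite lieDl !lieDr !liexx addr0 add0r addrC => ->.
Qed.

End LieBasics.

Section Nilpotent.
Variables (F : fieldType) (L : vectLieType F).

Lemma linear_pred_span (P : L -> Prop) (X : seq L) (v : L) :
  linear_pred P -> {in X, forall x, P x} -> v \in <<X>>%VS -> P v.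
Proof.
move=> Plin PX /(@coord_span _ _ _ (in_tuple X))->.
by apply: linear_pred_sum => // i; apply: PX; rewrite mem_nth.
Qed.

Lemma linear_pred_derived (P : L -> Prop) (v : L) :
  linear_pred P -> (forall x y : L, P (lie x y)) -> v \in derived L -> P v.
Proof.
by move=> Plin Plie; apply: linear_pred_span => // _ /allpairsP[[x y] [_ _ ->]].
Qed.

Lemma mem_derived (x y : L) : lie x y \in derived L.
Proof. exact: (elimT (lieprodvP _ _ _) (subvv _)) (memvf x) (memvf y). Qed.

Lemma mem_lower_central k (x y : L) :
  x \in lower_central L k -> lie x y \in lower_central L k.+1.
Proof. by move=> xk; apply: (elimT (lieprodvP _ _ _) (subvv _)) xk (memvf y). Qed.

(** Induction along the lower central series: a subalgebra supplementing
    [L^2] supplements each term, because bracketing two decompositions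
    [q + g] and [q' + g'] leaves [lie q q'] up to the next term. *)
Lemma nilpotent_generation (Q : L -> Prop) (U : {vspace L}) :
  lie_nilpotent L -> linear_pred Q ->
  (forall x y, Q x -> Q y -> Q (lie x y)) ->
  {in U, forall x, Q x} -> (U + derived L)%VS = fullv -> forall x, Q x.
Proof.
move=> [K LK0] Qlin Qlie QU defL.
have Qk k : forall x, exists2 g, g \in lower_central L k & Q (x - g).
  elim: k => [|k IHk] x.
    by exists x; rewrite ?memvf // subrr; case: Qlin.
  pose P y := exists2 g, g \in lower_central L k.+1 & Q (y - g).
  have Plin : linear_pred P.
    split=> [|c y z [g gk Qg] [h hk Qh]].
      by exists 0; rewrite ?mem0v // subrr; case: Qlin.
    exists (c *: g + h); first by rewrite memvD ?memvZ.
    have -> : c *: y + z - (c *: g + h) = c *: (y - g) + (z - h).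
      by rewrite scalerBr opprD addrACA.
    by case: Qlin => _; apply.
  have : x \in (U + derived L)%VS by rewrite defL memvf.
  case/memv_addP => [u Uu [d Dd ->]]; apply: (linear_predD Plin).
    by exists 0; rewrite ?mem0v // subr0; apply: QU.
  apply: linear_pred_derived Plin _ Dd => y z.
  have [[g gk Qg] [h hk Qh]] := (IHk y, IHk z).
  exists (lie g z + lie (y - g) h).
    apply: memvD; first exact: mem_lower_central.
    by rewrite lieC memvN mem_lower_central.
  suff -> : lie y z - (lie g z + lie (y - g) h) = lie (y - g) (z - h).
    exact: Qlie.
  rewrite -[in RHS](scaleN1r h) lieDr lieZr scaleN1r opprD addrA; congr (_ - _).
  by rewrite -(scaleN1r g) lieDl lieZl scaleN1r.
move=> x; have [g] := Qk K x.
by rewrite LK0 memv0 => /eqP->; rewrite subr0.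
Qed.

(** If [lie w x = c *: w] with [c != 0], then [w] lies in every term of the
    lower central series. *)
Lemma nilpotent_eigen c (w x : L) :
  lie_nilpotent L -> lie w x = c *: w -> lie w x = 0.
Proof.
move=> [K LK0] wx; case: (eqVneq c 0) => [c0|nz_c].
  by rewrite wx c0 scale0r.
suff wk k : w \in lower_central L k.
  by have := wk K; rewrite LK0 memv0 => /eqP->; rewrite lie0l.
elim: k => [|k /(mem_lower_central x)]; first exact: memvf.
by rewrite wx => /(memvZ c^-1); rewrite scalerK.
Qed.

End Nilpotent.

(** * Identities in the tensor square *)

Section Tensor.
Variables (F : fieldType) (L : lieAlgType F).
Implicit Types a b c x y : L.
Local Notation T := (tensor_square L).
Local Notation "a *t b" := (tensor a b) (at level 38).

Let rel s t : tensor_rel s t -> lpi (@tensor_rel F L) s = lpi _ t.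
Proof. by move=> st; apply/lpiP/lc_rel. Qed.

Lemma tensorZl k a b : (k *: a) *t b = k *: (a *t b).
Proof. by rewrite /tensor -lpiZ; apply/esym/rel/tr_scalel. Qed.
Lemma tensorZr k a b : a *t (k *: b) = k *: (a *t b).
Proof. by rewrite /tensor -lpiZ; apply/esym/rel/tr_scaler. Qed.
Lemma tensorDl a a' b : (a + a') *t b = a *t b + a' *t b.
Proof. by rewrite /tensor -lpiD; apply/rel/tr_addl. Qed.
Lemma tensorDr a b b' : a *t (b + b') = a *t b + a *t b'.
Proof. by rewrite /tensor -lpiD; apply/rel/tr_addr. Qed.
Lemma tensor_liel a a' b : lie a a' *t b = a *t lie a' b - a' *t lie a b.
Proof. by rewrite /tensor -lpiN -lpiD; apply/rel/tr_liel. Qed.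
Lemma tensor_lier a b b' : a *t lie b b' = lie b' a *t b - lie b a *t b'.
Proof. by rewrite /tensor -lpiN -lpiD; apply/rel/tr_lier. Qed.
Lemma lie_tensor a b a' b' : lie (a *t b) (a' *t b') = - (lie b a *t lie a' b').
Proof. by rewrite /tensor -lpiB -lpiN; apply/rel/tr_br. Qed.
Lemma tensor0l b : 0 *t b = 0.
Proof. by have := tensorZl 0 0 b; rewrite !scale0r. Qed.
Lemma tensor0r a : a *t 0 = 0.
Proof. by have := tensorZr 0 a 0; rewrite !scale0r. Qed.
Lemma tensorNl a b : (- a) *t b = - (a *t b).
Proof. by rewrite -!scaleN1r tensorZl. Qed.
Lemma tensorNr a b : a *t (- b) = - (a *t b).
Proof. by rewrite -!scaleN1r tensorZr. Qed.

Definition tensor_sym a b : T := a *t b + b *t a.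

(** The trilinear map [T(a, b, c) = tensor_sym (lie a b) c] alternates in its
    first two arguments and, by the expansions of [lie x y *t x] and
    [x *t lie x y], in the first and the third; so it is invariant under cyclic
    shifts.  Expanding both summands of [T(a, b, c)] by the defining relations
    gives [T(a, b, c) = T(b, c, a) - T(a, c, b) = 2 T(a, b, c)], whence
    [T = 0] in every characteristic. *)
Lemma tensor_sym_lie a b c : lie a b *t c = - (c *t lie a b).
Proof.
pose S x y z := tensor_sym (lie x y) z.
have Salt x y : S x y x = 0.
  rewrite /S /tensor_sym tensor_liel liexx tensor0r subr0 (lieC y x).
  by rewrite tensorNr addNr.
have S12 x y z : S x y z = - S y x z.
  by rewrite /S /tensor_sym (lieC x y) tensorNl tensorNr opprD.
have SDl x x' y z : S (x + x') y z = S x y z + S x' y z.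
  by rewrite /S /tensor_sym lieDl tensorDl tensorDr addrACA.
have SDr x y z z' : S x y (z + z') = S x y z + S x y z'.
  by rewrite /S /tensor_sym tensorDl tensorDr addrACA.
have S13 x y z : S x y z = - S z y x.
  apply/eqP; rewrite -addr_eq0; have := Salt (x + z) y.
  by rewrite SDl !SDr !Salt addr0 add0r => ->.
have Scyc x y z : S x y z = S y z x by rewrite S13 S12 opprK S13 S12 opprK.
have Sexp : S a b c = S b c a - S a c b.
  rewrite {1}/S /tensor_sym tensor_liel (tensor_lier c) addrACA -opprD.
  by rewrite /S /tensor_sym [a *t _ + _]addrC [b *t _ + _]addrC.
apply/eqP; rewrite -addr_eq0; change (S a b c == 0).
move/eqP: Sexp; rewrite -(Scyc a b c) (S12 a c b) opprK (Scyc c a b).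
by rewrite -[X in X == _]addr0 (inj_eq (addrI _)) eq_sym.
Qed.

(** Compare [lie a b *t c = - (c *t lie a b)] with the defining expansion of
    the left-hand side. *)
Lemma tensor_jacobi a b c :
  a *t lie b c + b *t lie c a + c *t lie a b = 0.
Proof.
rewrite -[X in _ + X]opprK -tensor_sym_lie tensor_liel (lieC c a) tensorNr.
exact: subrr.
Qed.

(** Brackets of elementary tensors are elementary tensors, so no Lie brackets
    are needed to generate. *)
Lemma tensor_linear_ind (P : T -> Prop) :
  linear_pred P -> (forall a b, P (a *t b)) -> forall t, P t.
Proof.
move=> Plin Pt.
(* Membership in the linear span of the elementary tensors, phrased through
   all linear predicates so that closure under brackets can be shown one
   argument at a time. *)
pose B (t : T) := forall P : T -> Prop,
  linear_pred P -> (forall a b, P (a *t b)) -> P t.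
suff Ball u : B u by move=> u; exact: (Ball u P).
have Blie s t : B s -> B t -> B (lie s t).
  move=> Bs Bt {Plin Pt}P Plin Pt; apply: (Bs (fun s => P (lie s t))).
    split=> [|k x y Px Py]; first by rewrite lie0l; case: Plin.
    by rewrite lie_linearl; case: Plin => _; apply.
  move=> a b; apply: (Bt (fun t => P (lie (a *t b) t))).
    split=> [|k x y Px Py]; first by rewrite lie0r; case: Plin.
    by rewrite lie_linearr; case: Plin => _; apply.
  by move=> a' b'; rewrite lie_tensor; apply: linear_predN.
elim/lpiW: u; elim=> [[a b]||s IHs t IHt|k t IHt|s IHs t IHt].
- by move=> Q _; apply.
- by move=> Q [].
- by move=> Q Qlin Qt; rewrite lpiD; apply: linear_predD; [|apply: IHs|apply: IHt].
- by move=> Q Qlin Qt; rewrite lpiZ; apply: linear_predZ; [|apply: IHt].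
- by rewrite lpiB; apply: Blie.
Qed.

End Tensor.

(** * The upper bound *)

Section UpperBound.
Variables (F : fieldType) (L : vectLieType F).
Hypothesis nilL : lie_nilpotent L.
Local Notation "a *t b" := (tensor a b) (at level 38).
Implicit Types (u v x y : L) (U A W : {vspace L}).

(** By the relation for [lie a a' *t b], the left factors [a] all of whose
    tensors satisfy [P] form a subalgebra; it contains [U], which generates. *)
Lemma tensor_generated U (P : tensor_square L -> Prop) :
  (U + derived L)%VS = fullv -> linear_pred P ->
  (forall u y, u \in U -> P (u *t y)) -> forall t, P t.
Proof.
move=> defL Plin PU; apply: tensor_linear_ind => // a.
apply: (nilpotent_generation (Q := fun a => forall b, P (a *t b)) nilL _ _ _ defL).
- split=> [b|c x y Px Py b]; first by rewrite tensor0l; case: Plin.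
  by rewrite tensorDl tensorZl; case: Plin => _; apply.
- by move=> x y Px Py b; rewrite tensor_liel; apply: linear_predB.
- by move=> u Uu b; apply: PU.
Qed.

(** If all brackets within [U] vanished, [U] would be a subalgebra, hence the
    whole of [L]. *)
Lemma nonabelian_pair U :
  ~ lie_abelian L -> (U + derived L)%VS = fullv ->
  exists u v, [/\ u \in U, v \in U & lie u v <> 0].
Proof.
move=> nabL defL; apply: contrapT => noUU; apply: nabL.
have U0 u v : u \in U -> v \in U -> lie u v = 0.
  by move=> Uu Uv; apply: contrapT => uv; apply: noUU; exists u, v.
have UT x : x \in U.
  move: x; apply: (nilpotent_generation nilL _ _ _ defL) => //.
    by split=> [|c x y Ux Uy]; rewrite ?mem0v // memvD ?memvZ.
  by move=> x y Ux Uy; rewrite U0 ?mem0v.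
by move=> x y; apply: U0.
Qed.

Definition tensor_span_seq u v A W : seq (tensor_square L) :=
  [seq u *t b | b <- lie u v :: vbasis W] ++
  [seq v *t b | b <- lie u v :: vbasis W] ++
  [seq a *t b | a <- vbasis A, b <- vbasis W].

Lemma size_tensor_span_seq u v A W :
  size (tensor_span_seq u v A W) = ((\dim W).+1.*2 + \dim A * \dim W)%N.
Proof.
by rewrite !size_cat /= size_allpairs !size_map !size_tuple addnA addnn.
Qed.

(** With [w = lie u v], the Jacobi-type identity writes [a *t w] as a
    combination of tensors whose left factor is [u] or [v]; so for [a] in
    [A] only a complement of the line of [w] is needed on the right. *)
Lemma tensor_span_seqP u v A W :
  (<[u]> + <[v]> + A + derived L)%VS = fullv ->
  (<[lie u v : L]> + W)%VS = fullv ->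
  forall t, lspan (tensor_span_seq u v A W) t.
Proof.
set w : L := lie u v => defL defW; set s := tensor_span_seq u v A W.
have slin := lspan_linear s.
have sX a X : {in X, forall b, lspan s (a *t b)} ->
    forall y, y \in <<X>>%VS -> lspan s (a *t y).
  move=> sa y; apply: (@linear_pred_span _ _ (fun y => lspan s (a *t y))) => //.
  split=> [|c b b' sb sb'].
    by rewrite tensor0r; case: slin.
  by rewrite tensorDr tensorZr; case: slin => _; apply.
have full_w y : y \in <<w :: vbasis W>>%VS.
  by rewrite span_cons (span_basis (vbasisP W)) defW memvf.
have su y : lspan s (u *t y).
  apply: sX (full_w y) => b wb; apply: lspan_mem.
  by rewrite mem_cat map_f.
have sv y : lspan s (v *t y).
  apply: sX (full_w y) => b wb; apply: lspan_mem.
  by rewrite !mem_cat [X in _ || (X || _)]map_f ?orbT.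
have sA a y : a \in A -> lspan s (a *t y).
  rewrite -{1}(span_basis (vbasisP A)).
  apply: (@linear_pred_span _ _ (fun a => lspan s (a *t y))).
    split=> [|c b b' sb sb']; first by rewrite tensor0l; case: slin.
    by rewrite tensorDl tensorZl; case: slin => _; apply.
  move=> {}a Aa; apply: sX (full_w y) => b; rewrite inE => /predU1P[->|Wb].
    have /eqP := tensor_jacobi a u v; rewrite -addrA addr_eq0 => /eqP->.
    by apply: (linear_predN slin); apply: (linear_predD slin).
  by apply: lspan_mem; rewrite !mem_cat allpairs_f ?orbT.
apply: (tensor_generated defL slin) => x y.
case/memv_addP => _ /memv_addP[_ /vlineP[c ->] [_ /vlineP[d ->] ->]] [a Aa ->].
rewrite !tensorDl !tensorZl.
apply: (linear_predD slin); last exact: sA.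
by apply: (linear_predD slin); apply: (linear_predZ _ slin).
Qed.

(** The complement [U] of [L^2] splits as the plane of [u], [v] and a space [A]
    of dimension [n - m - 2], so the generating sequence has
    [2 n + (n - m - 2) (n - 1)] members. *)
Lemma tensor_square_dim_leq (n m : nat) :
  \dim {: L} = n -> \dim (derived L) = m -> ~ lie_abelian L ->
  exists2 d, has_dim (tensor_square L) d & (d <= (n - m) * (n - 1) + 2)%N.
Proof.
move=> dimL dimL2 nabL.
pose U := ((derived L)^C)%VS.
have defL : (U + derived L)%VS = fullv by rewrite addvC addv_complf.
have dimU : \dim U = (n - m)%N by rewrite dimv_compl dimL dimL2.
have [u [v [Uu Uv /eqP nz_w]]] := nonabelian_pair nabL defL.
set w : L := lie u v in nz_w.
have free_uv : free [:: u; v].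
  rewrite free_cons seq1_free span_seq1; apply/andP; split.
    by apply: contraNN nz_w => /vlineP[c uE]; rewrite /w uE lieZl liexx scaler0.
  by apply: contraNN nz_w => /eqP v0; rewrite /w v0 lie0r.
pose A := (U :\: <<[:: u; v]>>)%VS; pose W := (<[w]>^C)%VS.
have sub_uv : (<<[:: u; v]>> <= U)%VS.
  by apply/span_subvP => x; rewrite !inE => /orP[] /eqP->.
have dim_uv : \dim <<[:: u; v]>> = 2 by apply/eqP.
have dimA : (\dim A + 2 = n - m)%N.
  by rewrite -dimU -(dimv_cap_compl U <<[:: u; v]>>) (capv_idPr sub_uv) dim_uv addnC.
have dimW : (\dim W + 1 = n)%N.
  by rewrite dim_compl_line.
have := @tensor_span_seqP u v A W; have := size_tensor_span_seq u v A W.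
set s := tensor_span_seq u v A W => sz_s span_s.
have -> : ((n - m) * (n - 1) + 2 = size s)%N.
  by rewrite sz_s -dimA -dimW addnK; lia.
apply: (@lspan_has_dim _ _ s); apply: span_s; last exact: addv_complf.
rewrite -[RHS]defL; congr (_ + _)%VS.
rewrite -(span_seq1 v) -span_cons addvC addv_diff; exact/addv_idPl.
Qed.

End UpperBound.

(** * Algebras attaining the bound with one-dimensional derived subalgebra *)

Lemma dim_heisenberg_abelian (F : fieldType) (k : nat) :
  \dim {: (heisenbergLie F * abelianLie F k)%type} = (3 + k)%N.
Proof. by rewrite dimvf -[LHS]/(1 * 3 + 1 * k)%N !mul1n. Qed.

Section Heisenberg.
Variables (F : fieldType) (L : vectLieType F).
Local Notation "a *t b" := (tensor a b) (at level 38).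

Section Extremal.
Variables (n : nat) (u v : L).
Hypotheses (nilL : lie_nilpotent L) (dimL : \dim {: L} = n).
Hypotheses (dimL2 : \dim (derived L) = 1).
Let w : L := lie u v.
Hypothesis nz_w : w != 0.

Let derivedE : derived L = <[w]>%VS.
Proof.
apply/eqP; rewrite eq_sym eqEdim dimL2 dim_vline nz_w andbT -memvE.
exact: mem_derived.
Qed.

Let lie_line (x y : L) : exists c, lie x y = c *: w.
Proof. by apply/vlineP; rewrite -derivedE mem_derived. Qed.

Let lie_w (x : L) : lie w x = 0.
Proof. by have [c] := lie_line w x; apply: nilpotent_eigen. Qed.

(** The centralizer of [u] and [v]. *)
Let Z : {vspace L} :=
  (lker (linfun (lie u : L -> L)) :&: lker (linfun (lie v : L -> L)))%VS.

Let memZ (z : L) : (z \in Z) = (lie u z == 0) && (lie v z == 0).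
Proof.
pose ad (y : L) : {linear L -> L} :=
  HB.pack (lie y : L -> L) (GRing.isLinear.Build F L L _ (lie y) (lie_linearr y)).
by rewrite memv_cap !memv_ker -[X in linfun X]/(ad u : L -> L)
  -[X in _ && (linfun X _ == 0)]/(ad v : L -> L) !lfunE.
Qed.

Let A : {vspace L} := (Z :\: <[w]>)%VS.

Let wZ : w \in Z.
Proof. by rewrite memZ !(lieC _ w) !lie_w oppr0 eqxx. Qed.

Let A_w : (A + <[w]>)%VS = Z.
Proof. by rewrite addv_diff; apply/addv_idPl; rewrite -memvE wZ. Qed.

Let AZ a : a \in A -> lie u a = 0 /\ lie v a = 0.
Proof.
move=> Aa; suff : a \in Z by rewrite memZ => /andP[/eqP-> /eqP->].
by rewrite -A_w -[a]addr0 memv_add ?mem0v.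
Qed.

(** As [derived L] is the line of [w = lie u v], the brackets of [x] with [u]
    and [v] are multiples [p *: w] and [q *: w]; these are also the brackets
    of [p *: v - q *: u]. *)
Let decompL : (<[u]> + <[v]> + Z)%VS = fullv.
Proof.
apply/eqP; rewrite eqEsubv subvf; apply/subvP=> x _.
have [[p up] [q vq]] := (lie_line u x, lie_line v x).
have -> : x = (- q *: u + p *: v) + (x - (- q *: u + p *: v)).
  by rewrite addrCA subrr addr0.
rewrite !memv_add ?memvZ ?memv_line // memZ.
rewrite -[- (_ + _)]scaleN1r !lieDr !lieZr !lieDr !lieZr up vq !liexx.
rewrite (lieC v u) -/w !scaler0 add0r addr0 !scaleN1r scalerN scaleNr opprK.
by rewrite !subrr eqxx.
Qed.

Let dimA : (\dim A + 3 = n)%N.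
Proof.
rewrite -dimL -decompL.
have Zuv : ((<[u]> + <[v]>) :&: Z = 0)%VS.
  apply/eqP; rewrite -subv0; apply/subvP=> x.
  rewrite memv_cap memZ => /andP[/memv_addP[_ /vlineP[a ->] [_ /vlineP[b ->] ->]]].
  rewrite !lieDr !lieZr !liexx !scaler0 add0r addr0 (lieC v u) scalerN -/w.
  rewrite oppr_eq0 !scaler_eq0 (negPf nz_w) !orbF => /andP[/eqP-> /eqP->].
  by rewrite !scale0r addr0 mem0v.
have uv0 : (<[u]> :&: <[v]> = 0)%VS.
  apply/eqP; rewrite -subv0; apply/subvP=> x.
  rewrite memv_cap => /andP[/vlineP[a ->]].
  case/vlineP=> b /(congr1 (fun x => lie x v)); rewrite !lieZl liexx scaler0 => /eqP.
  by rewrite scaler_eq0 (negPf nz_w) orbF => /eqP->; rewrite scale0r mem0v.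
have nz_u : u != 0 by apply: contraNN nz_w => /eqP u0; rewrite /w u0 lie0l.
have nz_v : v != 0 by apply: contraNN nz_w => /eqP v0; rewrite /w v0 lie0r.
rewrite dimv_disjoint_sum // dimv_disjoint_sum // !dim_vline nz_u nz_v.
by rewrite -A_w dimv_disjoint_sum ?capv_diff // dim_vline nz_w; lia.
Qed.

Let decompA : (<[u]> + <[v]> + A + <[w]>)%VS = fullv.
Proof. by rewrite -addvA A_w decompL. Qed.

(** Were [u *t w] zero, it could be dropped from the generating sequence,
    and the bound would be strict. *)
Let extremal_tensor_neq0 :
  has_dim (tensor_square L) ((n - 1) * (n - 1) + 2) -> u *t w != 0.
Proof.
move=> dimT; apply/eqP => uw0.
pose W := (<[w]>^C)%VS.
have dimW : (\dim W + 1 = n)%N.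
  by rewrite dim_compl_line.
have span_s : forall t, lspan (tensor_span_seq u v A W) t.
  by apply: tensor_span_seqP; rewrite ?derivedE ?addv_complf.
have := size_tensor_span_seq u v A W; move: span_s.
set s := tensor_span_seq u v A W => span_s sz_s.
have span_s' t : lspan (behead s) t.
  have s'lin := lspan_linear (behead s).
  apply: lspan_min (s'lin) _ (span_s t) => x; rewrite /s /= inE.
  by case/predU1P=> [->|/lspan_mem //]; rewrite uw0; case: s'lin.
have := has_dim_leq dimT span_s'; rewrite size_behead sz_s -/w.
have -> : n = (\dim A + 3)%N by rewrite dimA.
have -> : \dim W = (\dim A + 2)%N by move: dimW dimA; clear; lia.
by nia.
Qed.

(** In the identity of [tensor_jacobi] for [u], [a], [b] two terms vanish since
    [a] and [b] commute with [u]; the third is a multiple of [u *t w]. *)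
Let extremal_abelian :
  has_dim (tensor_square L) ((n - 1) * (n - 1) + 2) ->
  {in A &, forall a b, lie a b = 0}.
Proof.
move=> /extremal_tensor_neq0 nz_uw a b Aa Ab.
have [[ua _] [ub _]] := (AZ Aa, AZ Ab).
have := tensor_jacobi u a b; rewrite (lieC b u) ua ub oppr0 !tensor0r !addr0.
have [c ->] := lie_line a b; rewrite tensorZr => /eqP.
by rewrite scaler_eq0 (negPf nz_uw) orbF => /eqP->; rewrite scale0r.
Qed.

Lemma extremal_isomorphic :
  has_dim (tensor_square L) ((n - 1) * (n - 1) + 2) ->
  lie_isomorphic L (heisenbergLie F * abelianLie F (n - 3))%type.
Proof.
move=> /extremal_abelian abA.
have [X basisX] : exists X : (n - 3).-tuple L, basis_of A X.
  by rewrite -dimA addnK; exists (vbasis A); apply: vbasisP.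
have XA i : X`_i \in A.
  have [lt_i|le_i] := ltnP i (n - 3).
    by rewrite (basis_mem basisX) // mem_nth // size_tuple.
  by rewrite nth_default ?mem0v // size_tuple.
have lie_expand a b c a' b' c' d d' : d \in A -> d' \in A ->
    lie (a *: u + b *: v + c *: w + d) (a' *: u + b' *: v + c' *: w + d') =
    (a * b' - b * a') *: w.
  move=> Ad Ad'; have [[ud vd] [ud' vd']] := (AZ Ad, AZ Ad').
  rewrite !(lieDl, lieDr, lieZl, lieZr) !lie_w !(lieC _ w) !lie_w !liexx (lieC v u).
  rewrite ud' vd' (lieC d u) (lieC d v) ud vd (abA d d') // -/w.
  rewrite !(oppr0, scaler0, addr0, add0r).
  by rewrite scalerN scalerN !scalerA scalerBl.
pose M := (heisenbergLie F * abelianLie F (n - 3))%type.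
pose g (x : M) : L :=
  (x.1 : 'rV_3) 0 0 *: u + (x.1 : 'rV_3) 0 1 *: v + (x.1 : 'rV_3) 0 2 *: w
  + \sum_i (x.2 : 'rV_(n - 3)) 0 i *: X`_i.
have g_lin : linear g.
  move=> c x y; rewrite /g /= !mxE !scalerDr !scalerDl !scalerA.
  rewrite scaler_sumr; under eq_bigr do rewrite !mxE scalerDl -scalerA.
  rewrite big_split [RHS]addrACA; congr (_ + _).
  by rewrite [RHS]addrACA; congr (_ + _); rewrite [RHS]addrACA.
pose gL : {linear M -> L} := HB.pack g (GRing.isLinear.Build F M L _ g g_lin).
have g_surj x : exists y, gL y = x.
  have : x \in (<[u]> + <[v]> + A + <[w]>)%VS by rewrite decompA memvf.
  case/memv_addP=> _ /memv_addP[_ /memv_addP[_ /vlineP[a ->] [_ /vlineP[b ->] ->]]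
    [a' Aa' ->]] [_ /vlineP[c ->] ->].
  exists (\row_i [:: a; b; c]`_i, \row_i coord X i a').
  rewrite /gL /= /g /= !mxE /= addrAC; congr (_ + _ + _).
  rewrite [RHS](coord_basis basisX Aa').
  by apply: eq_bigr => i _; rewrite mxE.
have limg_g := limg_surj g_surj.
have g_inj : injective gL.
  suff /lker0P inj : lker (linfun gL) == 0%VS.
    by move=> x y gxy; apply: inj; rewrite !lfunE.
  rewrite -dimv_eq0 -(eqn_add2r n) -[X in (_ + X)%N]dimL -limg_g.
  have := limg_ker_dim (linfun gL) fullv; rewrite capfv => ->.
  by rewrite dim_heisenberg_abelian -dimA addnK addnC.
pose f x := projT1 (cid (g_surj x)).
have fK : cancel f gL by move=> x; apply: (projT2 (cid (g_surj x))).
have gK : cancel gL f by move=> x; apply: g_inj; rewrite fK.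
pose fL : {linear L -> M} :=
  HB.pack f (GRing.isLinear.Build F L M _ f (can2_linear gK fK)).
exists fL; split; last by exists gL.
move=> x y; apply: g_inj; rewrite fK -{1}[x]fK -{1}[y]fK.
rewrite -[f x]/(fL x) -[f y]/(fL y); move: (fL x) (fL y) => x' y'; rewrite /gL /= /g.
have suma (z : M) : \sum_i (z.2 : 'rV_(n - 3)) 0 i *: X`_i \in A.
  by apply: memv_suml => i _; apply: memvZ.
rewrite lie_expand //= !mxE /= big1 ?addr0 => [|i _]; last by rewrite mxE scale0r.
by rewrite !(mulr0, mulr1, scale0r, add0r).
Qed.

End Extremal.

End Heisenberg.

(** * The lower bound for Heisenberg plus abelian *)

Section LowerBound.
Variables (F : fieldType) (r : nat).
Local Notation M := (heisenbergLie F * abelianLie F r)%type.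
Local Notation N := ((2 + r) * (2 + r) + 2)%N.
Implicit Types x y z : M.

(** Coordinates of [M] adapted to [v1, v2 | v]: the [v1, v2] block, the
    coefficient of the central [v], and the image in the abelianization. *)
Definition plane_part x : 'rV[F]_2 := lsubmx (x.1 : 'rV_(2 + 1)).
Definition center_part x : F := rsubmx (x.1 : 'rV_(2 + 1)) 0 0.
Definition ab_part x : 'rV[F]_(2 + r) := row_mx (plane_part x) (x.2 : 'rV_r).

(** The first block is the tensor square of the abelianization, in which all
    tensors with a factor in [M^2] vanish.  The second block records [v1 *t v]
    and [v2 *t v], with the sign rule of [tensor_sym_lie]; it forgets
    [a *t v] for [a] in the abelian summand, which vanishes in the tensor
    square by [tensor_jacobi] applied to [a], [v1], [v2]. *)
Definition heis_pairing x y : abelianLie F N :=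
  row_mx (mxvec ((ab_part x)^T *m ab_part y))
         (center_part y *: plane_part x - center_part x *: plane_part y).

Let beta x y : F :=
  (x.1 : 'rV_3) 0 0 * (y.1 : 'rV_3) 0 1 - (x.1 : 'rV_3) 0 1 * (y.1 : 'rV_3) 0 0.

Let plane_lie x y : plane_part (lie x y) = 0.
Proof.
by apply/rowP; case=> [[|[|//]] lt_i]; rewrite !mxE mulr0.
Qed.

Let ab_lie x y : ab_part (lie x y) = 0.
Proof. by rewrite /ab_part plane_lie row_mx0. Qed.

Let center_lie x y : center_part (lie x y) = beta x y.
Proof. by rewrite /center_part !mxE /= mulr1. Qed.

Let plane_linear : linear plane_part.
Proof. by move=> c x y; rewrite /plane_part /= linearP. Qed.
Let ab_linear : linear ab_part.
Proof. by move=> c x y; rewrite /ab_part plane_linear scale_row_mx add_row_mx. Qed.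
Let center_linear c x y :
  center_part (c *: x + y) = c * center_part x + center_part y.
Proof. by rewrite /center_part !mxE. Qed.

Lemma heis_pairing_linearl y : linear (heis_pairing^~ y).
Proof.
have trP c (p q : 'rV[F]_(2 + r)) : (c *: p + q)^T = c *: p^T + q^T.
  by rewrite linearP.
move=> c x x'; rewrite /heis_pairing ab_linear plane_linear center_linear.
rewrite trP mulmxDl -scalemxAl linearP scale_row_mx add_row_mx.
congr row_mx; rewrite scalerDr scalerDl opprD addrACA scalerBr !scalerA.
by rewrite [_ * c]mulrC.
Qed.

Lemma heis_pairing_linearr x : linear (heis_pairing x).
Proof.
move=> c y y'; rewrite /heis_pairing ab_linear plane_linear center_linear.
rewrite mulmxDr -scalemxAr linearP scale_row_mx add_row_mx.
congr row_mx; rewrite scalerDr scalerDl opprD addrACA scalerBr !scalerA.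
by rewrite [_ * c]mulrC.
Qed.

(** The left-hand side is alternating and trilinear in the plane parts, which
    have only two coordinates. *)
Let beta_cycle x y z :
  beta x y *: plane_part z + beta y z *: plane_part x + beta z x *: plane_part y = 0.
Proof.
apply/rowP=> i; rewrite !mxE /beta; case: i => [[|[|//]] lt_i].
  rewrite (_ : lshift 1 _ = (0 : 'I_(2 + 1))); last exact: val_inj.
  ring.
rewrite (_ : lshift 1 _ = (1 : 'I_(2 + 1))); last exact: val_inj.
ring.
Qed.

Let betaC x y : beta x y = - beta y x.
Proof. by rewrite /beta opprB mulrC [X in _ - X]mulrC. Qed.

Lemma heis_pairing_liel x x' y :
  heis_pairing (lie x x') y = heis_pairing x (lie x' y) - heis_pairing x' (lie x y).
Proof.
rewrite /heis_pairing !ab_lie !plane_lie !center_lie !scaler0 trmx0 mul0mx !mulmx0.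
rewrite !linear0 opp_row_mx add_row_mx subrr sub0r !addr0; congr row_mx.
have /eqP := beta_cycle x x' y; rewrite -addrA addr_eq0 => /eqP->.
by rewrite opprK (betaC y x) scaleNr.
Qed.

Lemma heis_pairing_lier x y y' :
  heis_pairing x (lie y y') = heis_pairing (lie y' x) y - heis_pairing (lie y x) y'.
Proof.
rewrite /heis_pairing !ab_lie !plane_lie !center_lie !scaler0 trmx0 !mul0mx mulmx0.
rewrite !linear0 opp_row_mx add_row_mx subrr addr0 !sub0r; congr row_mx.
have /eqP := beta_cycle y y' x; rewrite addrAC addr_eq0 => /eqP <-.
by rewrite opprK (betaC y x) scaleNr addrK.
Qed.

Lemma heis_pairing_lie x y x' y' :
  lie (heis_pairing x y) (heis_pairing x' y') = - heis_pairing (lie y x) (lie x' y').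
Proof.
rewrite /heis_pairing !ab_lie !plane_lie mulmx0 !scaler0 subrr linear0 row_mx0.
by rewrite oppr0.
Qed.

(** The section of [ab_part] with no central component. *)
Definition ab_lift (p : 'rV[F]_(2 + r)) : M := (row_mx (lsubmx p) 0, rsubmx p).

Lemma heis_pairing_lift p q :
  heis_pairing (ab_lift p) (ab_lift q) = row_mx (mxvec (p^T *m q)) 0.
Proof.
rewrite /heis_pairing /ab_part /plane_part /center_part /= !row_mxKl !row_mxKr.
by rewrite !hsubmxK mxE !scale0r subrr.
Qed.

Definition heis_center : M := ((row_mx 0 1%:M : 'rV[F]_(2 + 1)), 0).

Lemma heis_pairing_center (p : 'rV[F]_2) :
  heis_pairing (ab_lift (row_mx p 0)) heis_center = row_mx 0 p.
Proof.
rewrite /heis_pairing /ab_part /plane_part /center_part /= !row_mxKl !row_mxKr.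
by rewrite row_mx0 mulmx0 linear0 !mxE eqxx scale1r scale0r subr0.
Qed.

(** The pairing factors through the tensor square, and its values include all
    matrix units of the first block and all vectors of the second. *)
Lemma heis_tensor_dim_geq (L : lieAlgType F) d :
  lie_isomorphic L M -> has_dim (tensor_square L) d -> (N <= d)%N.
Proof.
case=> f [f_lie [f' fK f'K]] dimT.
have [||||| p [_ pE] _] :=
  @tensor_square_univ F L (abelianLie F N) (fun a b => heis_pairing (f a) (f b)).
- by move=> b c a a'; rewrite linearP heis_pairing_linearl.
- by move=> a c b b'; rewrite linearP heis_pairing_linearr.
- by move=> a a' b; rewrite !f_lie heis_pairing_liel.
- by move=> a b b'; rewrite !f_lie heis_pairing_lier.
- by move=> a b a' b'; rewrite !f_lie heis_pairing_lie.
pose P (y : 'rV[F]_N) := exists t, p t = y.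
have Plin : linear_pred P.
  split=> [|c y z [s <-] [t <-]]; first by exists 0; rewrite linear0.
  by exists (c *: s + t); rewrite linearP.
have P_pair x y : P (heis_pairing x y).
  by exists (tensor (f' x) (f' y)); rewrite pE !f'K.
apply: (has_dim_surj (f := p : {linear _ -> 'rV[F]_N}) dimT) => y.
rewrite -[y]hsubmxK -{1}[rsubmx y]add0r -{1}[lsubmx y]addr0.
rewrite -add_row_mx; apply: (linear_predD Plin); last first.
  have := P_pair (ab_lift (row_mx (rsubmx y) 0)) heis_center.
  by rewrite heis_pairing_center.
rewrite -[X in row_mx X _]vec_mxK; set A := vec_mx _.
have Qlin : linear_pred (fun A => P (row_mx (mxvec A) 0)).
  split=> [|c B C PB PC]; first by rewrite linear0 row_mx0; case: Plin.
  rewrite linearP -[X in row_mx _ X]addr0 -[X in row_mx _ (X + _)](scaler0 _ c).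
  by rewrite -add_row_mx -scale_row_mx; case: Plin => _; apply.
change (P (row_mx (mxvec A) 0)).
rewrite [A]matrix_sum_delta; apply: (big_ind (fun A => P (row_mx (mxvec A) 0)))
  => [|B C PB PC|i _].
- by case: Qlin.
- exact: (linear_predD Qlin).
apply: (linear_pred_sum _ Qlin) => j.
have := P_pair (ab_lift (delta_mx 0 i)) (ab_lift (delta_mx 0 j)).
by rewrite heis_pairing_lift trmx_delta mul_delta_mx.
Qed.

End LowerBound.

(** * The theorem *)

Theorem theorem3p4 (F : fieldType) (L : vectLieType F) (n m : nat) :
  \dim {: L} = n ->
  ~ lie_abelian L ->
  lie_nilpotent L ->
  \dim (derived L) = m ->
  (exists2 d : nat, has_dim (tensor_square L) d
                  & (d <= (n - m) * (n - 1) + 2)%N)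
  /\
  (m = 1%N ->
     (has_dim (tensor_square L) ((n - m) * (n - 1) + 2)
      <-> lie_isomorphic L (heisenbergLie F * abelianLie F (n - 3))%type)).
Proof.
move=> dimL nabL nilL dimL2.
have [d dimT le_d] := tensor_square_dim_leq nilL dimL dimL2 nabL.
split=> [|m1]; first by exists d.
rewrite {m}m1 in dimL2 le_d *; split=> [dimN | isoL].
  have [u [v [_ _ /eqP uv0]]] :=
    nonabelian_pair nilL nabL (addv_idPl (subvf (derived L))).
  exact: extremal_isomorphic nilL dimL dimL2 uv0 dimN.
have n_ge3 : (3 <= n)%N.
  have [f [_ [g _ gK]]] := isoL.
  have f_surj y : exists x, f x = y by exists (g y).
  have := limg_ker_dim (linfun f) fullv.
  rewrite (limg_surj f_surj) dimL dim_heisenberg_abelian => <-.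
  by rewrite addnCA leq_addr.
have := heis_tensor_dim_geq isoL dimT.
have -> : (2 + (n - 3) = n - 1)%N by lia.
move=> ge_d; have <- // : d = ((n - 1) * (n - 1) + 2)%N.
by apply/eqP; rewrite eqn_leq le_d.
Qed.
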